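(* Let $G=(V,E)$ be a finite undirected graph with $n=|V|$, let $d:E\to\mathbb{R}^+$, let $k,\alpha\ge 2$ be integers, and put $\beta=n-(k-1)\alpha$. Let $S\subset V$ be nonempty with $|S|<\alpha$, and let $\delta(S)$ be the set of edges of $G$ with exactly one end node in $S$. Then $$\sum_{c\in[k]}\ \sum_{\{i,j\}\in\delta(S)}x_{ij}^c\ \ge\ 1$$ is valid for the model $(\mathcal{M}_1)$, and $$\sum_{\{i,j\}\in\delta(S)}x_{ij}\ \ge\ 1$$ is valid for the model $(\mathcal{M}_2)$.
   Context: Notation: $V=\{1,\dots,n\}$, $[k]=\{1,\dots,k\}$, $\bar E=\{\{i,j\}\notin E: i,j\in V, i\ne j\}$. An (in)equality is valid for a model if every feasible solution of the model satisfies it. Each edge $\{i,j\}$ has two associated antiparallel arcs $(i,j)$, $(j,i)$; $\delta^-_j$ and $\delta^+_j$ are the sets of arcs entering and leaving node $j$. Variables indexed by edges are symmetric ($x_{ij}=x_{ji}$); flow variables are indexed by arcs. Both models describe partitions of $V$ into $k$ sets $V_1,\dots,V_k$ (with $y_i^c=1$ iff $i\in V_c$), each inducing a connected subgraph and having at least $\alpha$ nodes, minimizing the total cost of edges with both ends in the same set. Model $(\mathcal{M}_1)$: variables $y_i^c\in\{0,1\}$ ($i\in V,c\in[k]$), $x_{ij}^c\in\{0,1\}$ ($\{i,j\}\in E,c\in[k]$), $\bar x_{ij}^c\in\{0,1\}$ ($\{i,j\}\in\bar E,c\in[k]$), and $f_{ij}^{lc}\ge 0$ real for both arcs $(i,j)$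 of each edge of $E$, $l\in V$, $c\in[k]$. Minimize $\sum_{c\in[k]}\sum_{\{i,j\}\in E}d_{ij}x_{ij}^c$ subject to: (1) $\sum_{c\in[k]}y_i^c=1$ for all $i\in V$; (2) $y_i^c+y_j^c-x_{ij}^c\le1$ and $y_i^c+y_j^c-2x_{ij}^c\ge0$ for all $\{i,j\}\in E$, $c\in[k]$; (3) $y_i^c+y_j^c-\bar x_{ij}^c\le1$ and $y_i^c+y_j^c-2\bar x_{ij}^c\ge0$ for all $\{i,j\}\in\bar E$, $c\in[k]$; (4) $\sum_{l\in V}(f_{ij}^{lc}+f_{ji}^{lc})\le 2nk\,x_{ij}^c$ for all $\{i,j\}\in E$, $c\in[k]$; (5) for all $(l,j)\in V\times V$, $c\in[k]$: $\sum_{(i,j)\in\delta^-_j}f_{ij}^{lc}-\sum_{(j,i)\in\delta^+_j}f_{ji}^{lc}$ equals $-\sum_{i:\{j,i\}\in\bar E}\bar x_{ji}^c$ if $j=l$, equals $0$ if $\{l,j\}\in E$, and equals $\bar x_{lj}^c$ otherwise; (6) $\sum_{i\in V}y_i^c\ge\alpha$ for all $c\in[k]$. Model $(\mathcal{M}_2)$: let $\mathbb{A}=\{n+1,\dots,n+k\}$ be artificial nodes and $E^k=E\cup\{\{i,j\}:i\in V,j\in\mathbb{A}\}$; arcs and the sets $\delta^\pm_j$ refer to the graph $(V\cup\mathbb{A},E^k)$. Variables $y_i^c\in\{0,1\}$ ($i\in V,c\in[k]$), $x_{ij}\in\{0,1\}$ ($\{i,j\}\in E^k$), and $f_{ij}\ge0$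 real for both arcs of each edge of $E^k$. Minimize $\sum_{\{i,j\}\in E}d_{ij}x_{ij}$ subject to: (1) $\sum_{c\in[k]}y_i^c=1$ for all $i\in V$; (2) $y_i^c+y_j^c-x_{ij}\le1$ for all $\{i,j\}\in E$, $c\in[k]$; (3) $y_i^c+y_j^\ell+x_{ij}\le2$ for all $\{i,j\}\in E$, $c,\ell\in[k]$, $c\ne\ell$; (4) $\sum_{j\in V}x_{ij}=1$ and $\sum_{j\in V}f_{ij}=\sum_{j\in V}y_j^{i-n}$ for all $i\in\mathbb{A}$; (5) $\sum_{(i,j)\in\delta^-_j}f_{ij}-\sum_{(j,i)\in\delta^+_j}f_{ji}=1$ for all $j\in V$; (6) $f_{ij}+f_{ji}\le\beta x_{ij}$ for all $\{i,j\}\in E$; (7) $\alpha x_{ij}\le f_{ij}\le\beta x_{ij}$ for all $i\in\mathbb{A}$, $j\in V$. *)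

(* Defs.v *)
From HB Require Import structures.
From mathcomp Require Import all_boot all_order all_algebra.

Set Implicit Arguments.
Unset Strict Implicit.
Unset Printing Implicit Defensive.

Import Order.TTheory GRing.Theory Num.Theory.

Local Open Scope ring_scope.

Section Graphs.
Variables (T : finType) (E : {set {set T}}).

(* A graph on T is given by its set of edges, an edge {i, j} being a set with
   two elements.  A variable indexed by edges is a function on {set T}, so that
   x_ij = x_ji holds by construction; only its values on edges matter. *)
Definition simple_edges : Prop := forall e, e \in E -> #|e| = 2%N.

(* For simple E this is the set of edges of the complement graph. *)
Definition nonedges : {set {set T}} := [set e : {set T} | (#|e| == 2)%N && (e \notin E)].

Definition cut (S : {set T}) : {set {set T}} := [set e in E | #|e :&: S| == 1%N].

Definition arcs : {set T * T} := [set a : T * T | [set a.1; a.2] \in E].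

Definition in_arcs (j : T) : {set T * T} := [set a in arcs | a.2 == j].

Definition out_arcs (j : T) : {set T * T} := [set a in arcs | a.1 == j].

End Graphs.

(* A minimization problem. *)
Record model (R : Type) := Model {
  solution : Type;
  feasible : solution -> Prop;
  objective : solution -> R
}.

Definition valid (R : Type) (M : model R) (P : solution M -> Prop) : Prop :=
  forall s : solution M, feasible s -> P s.

Section Models.
Variables (R : realFieldType) (n k : nat).

Definition binary (r : R) : Prop := r = 0 \/ r = 1.

Section Model1.

(* y1 i c, x1 c {i, j}, xbar1 c {i, j} and f1 l c (i, j) stand for y_i^c,
   x_ij^c, \bar x_ij^c and f_ij^{lc}. *)
Record vars1 := Vars1 {
  y1 : 'I_n -> 'I_k -> R;
  x1 : 'I_k -> {set 'I_n} -> R;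
  xbar1 : 'I_k -> {set 'I_n} -> R;
  f1 : 'I_n -> 'I_k -> 'I_n * 'I_n -> R
}.

Variables (E : {set {set 'I_n}}) (d : {set 'I_n} -> R) (alpha : nat).

Record feasible1 (s : vars1) : Prop := Feasible1 {
  y1_binary : forall i c, binary (y1 s i c);
  x1_binary : forall c e, e \in E -> binary (x1 s c e);
  xbar1_binary : forall c e, e \in nonedges E -> binary (xbar1 s c e);
  f1_ge0 : forall l c a, a \in arcs E -> 0 <= f1 s l c a;
  assign1 : forall i, \sum_c y1 s i c = 1;
  edge1 : forall i j c, [set i; j] \in E ->
    y1 s i c + y1 s j c - x1 s c [set i; j] <= 1 /\
    y1 s i c + y1 s j c - 2 * x1 s c [set i; j] >= 0;
  nonedge1 : forall i j c, [set i; j] \in nonedges E ->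
    y1 s i c + y1 s j c - xbar1 s c [set i; j] <= 1 /\
    y1 s i c + y1 s j c - 2 * xbar1 s c [set i; j] >= 0;
  capacity1 : forall i j c, [set i; j] \in E ->
    \sum_l (f1 s l c (i, j) + f1 s l c (j, i))
      <= 2 * n%:R * k%:R * x1 s c [set i; j];
  balance1 : forall l j c,
    \sum_(a in in_arcs E j) f1 s l c a - \sum_(a in out_arcs E j) f1 s l c a =
    if j == l then - \sum_(i | [set j; i] \in nonedges E) xbar1 s c [set j; i]
    else if [set l; j] \in E then 0
    else xbar1 s c [set l; j];
  size1 : forall c, \sum_i y1 s i c >= alpha%:R
}.

Definition M1 : model R :=
  Model feasible1 (fun s => \sum_c \sum_(e in E) d e * x1 s c e).

End Model1.

Section Model2.

(* inl i is the node i of V, and inr c is the artificial node n + c. *)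
Definition node2 : finType := ('I_n + 'I_k)%type.

Definition old (i : 'I_n) : node2 := inl i.
Definition art (c : 'I_k) : node2 := inr c.

(* An edge of G, seen as an edge of the extended graph. *)
Definition old_edge (e : {set 'I_n}) : {set node2} := [set old i | i in e].

Record vars2 := Vars2 {
  y2 : 'I_n -> 'I_k -> R;
  x2 : {set node2} -> R;
  f2 : node2 * node2 -> R
}.

Variables (E : {set {set 'I_n}}) (d : {set 'I_n} -> R) (alpha : nat).

Definition Ek : {set {set node2}} :=
  [set old_edge e | e in E] :|:
  [set [set old i; art c] | i : 'I_n, c : 'I_k].

(* A subtraction in R: nothing is truncated at 0. *)
Definition beta : R := n%:R - (k%:R - 1) * alpha%:R.

Record feasible2 (s : vars2) : Prop := Feasible2 {
  y2_binary : forall i c, binary (y2 s i c);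
  x2_binary : forall e, e \in Ek -> binary (x2 s e);
  f2_ge0 : forall a, a \in arcs Ek -> 0 <= f2 s a;
  assign2 : forall i, \sum_c y2 s i c = 1;
  same2 : forall i j c, [set i; j] \in E ->
    y2 s i c + y2 s j c - x2 s (old_edge [set i; j]) <= 1;
  diff2 : forall i j c l, [set i; j] \in E -> c != l ->
    y2 s i c + y2 s j l + x2 s (old_edge [set i; j]) <= 2;
  root2 : forall c, \sum_j x2 s [set art c; old j] = 1;
  supply2 : forall c, \sum_j f2 s (art c, old j) = \sum_j y2 s j c;
  balance2 : forall j : 'I_n,
    \sum_(a in in_arcs Ek (old j)) f2 s a -
    \sum_(a in out_arcs Ek (old j)) f2 s a = 1;
  capacity2 : forall i j, [set i; j] \in E ->
    f2 s (old i, old j) + f2 s (old j, old i)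
      <= beta * x2 s (old_edge [set i; j]);
  root_capacity2 : forall c j,
    alpha%:R * x2 s [set art c; old j] <= f2 s (art c, old j)
      <= beta * x2 s [set art c; old j]
}.

Definition M2 : model R :=
  Model feasible2 (fun s => \sum_(e in E) d e * x2 s (old_edge e)).

End Model2.

End Models.

(* Main.v *)
(** If all the variables on the cut of S vanish, no flow crosses it.

    In the first model, let l in S belong to the class c.  This class has at
    least alpha > |S| nodes, so it has a node m outside S.  The edge {l, m} would
    be in the cut with x = 1, so it is a nonedge with xbar = 1, and the flow of
    commodity (l, c) delivers at least one unit to the complement of S.

    In the second model, the balance of all of V shows that nothing flows back
    to the artificial nodes, since these already send out exactly n units.  So
    the |S| > 0 units consumed in S come directly from artificial nodes, but
    such a flow is either 0 or at least alpha > |S|. *)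
Require Import Defs.
From HB Require Import structures.
From mathcomp Require Import all_boot all_order all_algebra.

Set Implicit Arguments.
Unset Strict Implicit.
Unset Printing Implicit Defensive.

Import Order.TTheory GRing.Theory Num.Theory.

Local Open Scope ring_scope.

(** * Sums of nonnegative terms, flow balance and cuts *)

Lemma binary_ge0 (R : realFieldType) (r : R) : binary r -> 0 <= r.
Proof. by case=> ->. Qed.

Lemma sumr_ge0_eq0 (R : realFieldType) (I : finType) (P : pred I) (F : I -> R) :
    (forall i, P i -> 0 <= F i) -> \sum_(i | P i) F i <= 0 ->
  forall i, P i -> F i = 0.
Proof.
move=> F_ge0 le0 i Pi; apply: (psumr_eq0P F_ge0) => //.
by apply/eqP; rewrite eq_le le0 sumr_ge0.
Qed.

Lemma ler_sum_term (R : realFieldType) (I : finType) (P : pred I) (F : I -> R) i :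
  (forall j, P j -> 0 <= F j) -> P i -> F i <= \sum_(j | P j) F j.
Proof.
move=> F_ge0 Pi; rewrite (bigD1 i) //= lerDl.
by apply: sumr_ge0 => j /andP[Pj _]; apply: F_ge0.
Qed.

(** A single term equal to 1 would already bring the sum to 1, the others being nonnegative. *)
Lemma sum_binary_lt1 (R : realFieldType) (I : finType) (P : pred I) (F : I -> R) :
    (forall i, P i -> binary (F i)) -> \sum_(i | P i) F i < 1 ->
  forall i, P i -> F i = 0.
Proof.
move=> Fbin lt1 i Pi; case: (Fbin i Pi) => // Fi1; move: lt1.
rewrite ltNge -Fi1 ler_sum_term // => j Pj.
exact/binary_ge0/Fbin.
Qed.

(** An arc with both ends in [U] is counted once as entering and once as leaving, so it cancels and
    only the crossing arcs remain. *)
Lemma sum_balance (R : realFieldType) (T : finType) (E : {set {set T}})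
    (f : T * T -> R) (U : {set T}) :
  \sum_(j in U) (\sum_(a in in_arcs E j) f a - \sum_(a in out_arcs E j) f a) =
  \sum_(a in arcs E | (a.1 \notin U) && (a.2 \in U)) f a -
  \sum_(a in arcs E | (a.1 \in U) && (a.2 \notin U)) f a.
Proof.
(* To be used with [g] the head of an arc, then with [g] its tail. *)
have group_by (g : T * T -> T) : \sum_(j in U) \sum_(a in arcs E | g a == j) f a =
    \sum_(a in arcs E | g a \in U) f a.
  rewrite (exchange_big_dep (fun a => (a \in arcs E) && (g a \in U))) /=; last first.
    by move=> j a jU /andP[-> /eqP->].
  apply: eq_bigr => a /andP[aE gaU]; rewrite (big_pred1 (g a)) // => j /=.
  by rewrite aE /= eq_sym; case: eqP => [->|]; rewrite ?gaU ?andbF ?andbT.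
rewrite sumrB.
under eq_bigr do under eq_bigl do rewrite inE.
rewrite group_by; under [X in _ - X]eq_bigr do under eq_bigl do rewrite inE.
rewrite group_by.
pose inner := \sum_(a in arcs E | (a.1 \in U) && (a.2 \in U)) f a.
rewrite [X in X - _](_ : _ = inner +
    \sum_(a in arcs E | (a.1 \notin U) && (a.2 \in U)) f a); last first.
  rewrite (bigID (fun a => a.1 \in U)) /=; congr (_ + _);
    by apply: eq_bigl => a; rewrite -andbA [X in _ && X]andbC.
rewrite [X in _ - X](_ : _ = inner +
    \sum_(a in arcs E | (a.1 \in U) && (a.2 \notin U)) f a); last first.
  by rewrite (bigID (fun a => a.2 \in U)) /=; congr (_ + _);
    apply: eq_bigl => a; rewrite -andbA.
by rewrite opprD addrACA subrr add0r.
Qed.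

Lemma crossing_cut (T : finType) (E : {set {set T}}) (S : {set T}) (i j : T) :
  [set i; j] \in E -> i \in S -> j \notin S -> [set i; j] \in cut E S.
Proof.
move=> ijE iS jS; rewrite inE ijE /=; apply/cards1P; exists i.
apply/setP=> u; rewrite !inE; case: eqP => [->|_]; rewrite ?iS //=.
by case: eqP => // ->; apply: negbTE.
Qed.

(** * The first model *)

Lemma cut1_valid (R : realFieldType) (n k alpha : nat) (E : {set {set 'I_n}})
    (S : {set 'I_n}) (s : vars1 R n k) :
  S != set0 -> (#|S| < alpha)%N -> feasible1 E alpha s ->
  \sum_c \sum_(e in cut E S) x1 s c e >= 1.
Proof.
move=> hS0 hS fs; rewrite leNgt; apply/negP => lt1.
have x0 c e : e \in cut E S -> x1 s c e = 0.
  move=> eS; rewrite pair_big /= in lt1.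
  apply: (sum_binary_lt1 _ lt1 (i := (c, e))) => //= -[c' e'] /=.
  by rewrite inE => /andP[e'E _]; apply: (x1_binary fs).
have f0 l c i j : [set i; j] \in cut E S ->
    f1 s l c (i, j) = 0 /\ f1 s l c (j, i) = 0.
  move=> ijS; have ijE : [set i; j] \in E by move: ijS; rewrite inE => /andP[].
  have ge0 l' : 0 <= f1 s l' c (i, j) /\ 0 <= f1 s l' c (j, i).
    by split; apply: (f1_ge0 fs); rewrite inE //= setUC.
  (* With x = 0 the capacity bounds by 0 the flow of all commodities in both directions, a sum of
     nonnegative terms. *)
  have := capacity1 fs c ijE; rewrite x0 // mulr0 => le0.
  have : f1 s l c (i, j) + f1 s l c (j, i) == 0.
    apply/eqP; apply: (sumr_ge0_eq0 _ le0) => // l' _.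
    by have [] := ge0 l'; apply: addr_ge0.
  by have [ge01 ge02] := ge0 l; rewrite paddr_eq0 // => /andP[/eqP-> /eqP->].
have [l lS] := set0Pn _ hS0.
have [c ylc] : exists c, y1 s l c = 1.
  have [/existsP[c /eqP ylc]|/existsPn y0] := boolP [exists c, y1 s l c == 1].
    by exists c.
  have := assign1 fs l; rewrite big1 => [/eqP|c _]; first by rewrite eq_sym oner_eq0.
  by case: (y1_binary fs l c) => // /eqP; rewrite (negbTE (y0 c)).
have [m mS ymc] : exists2 m, m \notin S & y1 s m c = 1.
  have [/existsP[m /andP[mS /eqP ymc]]|/existsPn y0] :=
    boolP [exists m, (m \notin S) && (y1 s m c == 1)]; first by exists m.
  (* Otherwise the class [c] lies inside [S], and its size is at most #|S| < [alpha]. *)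
  have := size1 fs c; rewrite (bigID (mem S)) /= [X in _ + X]big1 => [|m mS].
    rewrite addr0 leNgt => /negP[]; apply: le_lt_trans (_ : #|S|%:R < _).
      rewrite -sumr_const; apply: ler_sum => m _.
      by case: (y1_binary fs m c) => ->.
    by rewrite ltr_nat.
  case: (y1_binary fs m c) => // /eqP ym.
  by have := y0 m; rewrite mS ym.
have neq_l j : j \notin S -> (j == l) = false.
  by move=> jS; apply: contraNF jS => /eqP->.
have nonedge_l j : j \notin S -> [set l; j] \notin E -> [set l; j] \in nonedges E.
  by move=> jS ljE; rewrite inE ljE cards2 [l == j]eq_sym neq_l.
have lmE : [set l; m] \notin E.
  apply/negP => lmE; have [] := edge1 fs c lmE.
  by rewrite ylc ymc x0 ?crossing_cut // subr0 gerDl ler10.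
have xlm : xbar1 s c [set l; m] = 1.
  have lmN := nonedge_l _ mS lmE.
  case: (xbar1_binary fs c lmN) => // xlm0; have [] := nonedge1 fs c lmN.
  by rewrite ylc ymc xlm0 subr0 gerDl ler10.
(* The right-hand side of the balance at a node other than the source [l]. *)
pose demand j := if [set l; j] \in E then 0 else xbar1 s c [set l; j].
have demand_ge0 j : j \in ~: S -> 0 <= demand j.
  rewrite inE /demand => jS; case: ifPn => // ljE.
  exact/binary_ge0/(xbar1_binary fs)/nonedge_l.
(* Since [l] is in [S], the demands outside [S] add up to the net flow into the complement of [S],
   which is 0 because all crossing arcs carry 0. *)
have dem0 : \sum_(j in ~: S) demand j = 0.
  transitivity (\sum_(j in ~: S) (\sum_(a in in_arcs E j) f1 s l c a -
                                  \sum_(a in out_arcs E j) f1 s l c a)).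
    by apply: eq_bigr => j; rewrite inE => jS; rewrite (balance1 fs) neq_l.
  rewrite sum_balance !big1 ?subr0 // => -[i j]; rewrite !inE /= ?negbK.
    case/andP=> ijE /andP[iS jS]; rewrite setUC in ijE.
    by have [] := f0 l c _ _ (crossing_cut ijE jS iS).
  by case/andP=> ijE /andP[iS jS]; have [] := f0 l c _ _ (crossing_cut ijE iS jS).
have mC : m \in ~: S by rewrite inE.
have := ler_sum_term demand_ge0 mC.
by rewrite dem0 /demand (negbTE lmE) xlm ler10.
Qed.

(** * The second model *)

Lemma mem_Ek_old (n k : nat) (E : {set {set 'I_n}}) (i j : 'I_n) :
  ([set old k i; old k j] \in Ek k E) = ([set i; j] \in E).
Proof.
have -> : [set old k i; old k j] = old_edge k [set i; j].
  by rewrite /old_edge imsetU1 imset_set1.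
have old_inj : injective (old k : 'I_n -> _) by move=> u v [].
rewrite inE mem_imset; last exact: imset_inj.
(* An edge of the second kind contains an artificial node, unlike a pair of old nodes. *)
apply/orb_idr => /imset2P[u c _ _ /setP/(_ (art n c))].
by rewrite !inE eqxx orbT => /imsetP[].
Qed.

Lemma mem_Ek_art (n k : nat) (E : {set {set 'I_n}}) (i : 'I_n) (c : 'I_k) :
  [set old k i; art n c] \in Ek k E.
Proof. by rewrite inE; apply/orP; right; apply: imset2_f. Qed.

Lemma balance_set2 (R : realFieldType) (n k alpha : nat) (E : {set {set 'I_n}})
    (s : vars2 R n k) (S : {set 'I_n}) (U := [set old k i | i in S]) :
  feasible2 E alpha s ->
  \sum_(a in arcs (Ek k E) | (a.1 \notin U) && (a.2 \in U)) f2 s a -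
  \sum_(a in arcs (Ek k E) | (a.1 \in U) && (a.2 \notin U)) f2 s a = #|S|%:R.
Proof.
move=> fs; rewrite -sum_balance big_imset /=; last by move=> i j _ _ [].
by rewrite -sumr_const; apply: eq_bigr => j _; apply: (balance2 fs).
Qed.

(** The root capacities bound only the flow leaving the artificial nodes; the reverse flow is
    controlled through the balance of the whole of [V]. *)
Lemma flow_to_art_eq0 (R : realFieldType) (n k alpha : nat) (E : {set {set 'I_n}})
    (s : vars2 R n k) (i : 'I_n) (c : 'I_k) :
  feasible2 E alpha s -> f2 s (old k i, art n c) = 0.
Proof.
move=> fs; set V := [set old k j | j in [set: 'I_n]].
have oldV j : old k j \in V by apply: imset_f.
have artV c' : art n c' \in V = false by apply/imsetP => -[].
have := balance_set2 [set: 'I_n] fs; rewrite -/V cardsT card_ord.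
(* The arcs entering [V] are exactly those from an artificial node to an old one. *)
rewrite (eq_bigl (mem [set (art n p.1, old k p.2) | p : 'I_k * 'I_n])); last first.
  move=> [[u|u] [v|v]]; rewrite /= [_ \in arcs _]inE /=.
  - by rewrite oldV andbF; apply/esym/imsetP => -[].
  - by rewrite oldV andbF; apply/esym/imsetP => -[].
  - rewrite artV oldV setUC mem_Ek_art; apply/esym/imsetP.
    by exists (u, v).
  - by rewrite !artV !andbF; apply/esym/imsetP => -[].
rewrite big_imset /=; last by move=> [u v] [u' v'] _ _ [-> ->].
rewrite -(pair_bigA _ (fun c j => f2 s (art n c, old k j))) /=.
under eq_bigr do rewrite (supply2 fs).
(* The class sizes add up to n, as each node is in exactly one class. *)
rewrite exchange_big /=; under eq_bigr do rewrite (assign2 fs).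
rewrite sumr_const card_ord => out0.
have le0 : \sum_(a in arcs (Ek k E) | (a.1 \in V) && (a.2 \notin V)) f2 s a <= 0.
  by rewrite -(gerDl n%:R) -[X in X + _]out0 subrK.
apply: (sumr_ge0_eq0 _ le0) => [a /andP[aE _]|].
  exact: (f2_ge0 fs).
by rewrite [_ \in arcs _]inE mem_Ek_art oldV artV.
Qed.

Lemma cut2_valid (R : realFieldType) (n k alpha : nat) (E : {set {set 'I_n}})
    (S : {set 'I_n}) (s : vars2 R n k) :
  S != set0 -> (#|S| < alpha)%N -> feasible2 E alpha s ->
  \sum_(e in cut E S) x2 s (old_edge k e) >= 1.
Proof.
move=> hS0 hS fs; rewrite leNgt; apply/negP => lt1.
have x0 e : e \in cut E S -> x2 s (old_edge k e) = 0.
  apply: (sum_binary_lt1 _ lt1) => e'; rewrite inE => /andP[e'E _].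
  by apply: (x2_binary fs); rewrite inE imset_f.
have f0 i j : [set i; j] \in cut E S ->
    f2 s (old k i, old k j) = 0 /\ f2 s (old k j, old k i) = 0.
  move=> ijS; have ijE : [set i; j] \in E by move: ijS; rewrite inE => /andP[].
  have ge01 : 0 <= f2 s (old k i, old k j).
    by apply: (f2_ge0 fs); rewrite inE mem_Ek_old.
  have ge02 : 0 <= f2 s (old k j, old k i).
    by apply: (f2_ge0 fs); rewrite inE mem_Ek_old setUC.
  have := capacity2 fs ijE; rewrite x0 // mulr0 => le0.
  have : f2 s (old k i, old k j) + f2 s (old k j, old k i) == 0.
    by rewrite eq_le le0 addr_ge0.
  by rewrite paddr_eq0 // => /andP[/eqP-> /eqP->].
have memU i : (old k i \in [set old k i | i in S]) = (i \in S).
  by rewrite mem_imset // => u v [].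
have := balance_set2 S fs; set U := [set old k i | i in S].
(* Nothing leaves [S]: arcs to old nodes cross the cut, and arcs to artificial nodes carry no
   flow. *)
rewrite [X in _ - X]big1 ?subr0 => [inS|[p q]]; last first.
  rewrite inE /= => /andP[pqE /andP[/imsetP[i iS pE]]]; rewrite {p}pE in pqE *.
  case: q pqE => [j|c] pqE qU; last exact: flow_to_art_eq0 fs.
  rewrite mem_Ek_old in pqE; rewrite memU in qU.
  by have [] := f0 _ _ (crossing_cut pqE iS qU).
have in_ge0 a : (a \in arcs (Ek k E)) && ((a.1 \notin U) && (a.2 \in U)) ->
    0 <= f2 s a by move=> /andP[aE _]; apply: (f2_ge0 fs).
have : \sum_(a in arcs (Ek k E) | (a.1 \notin U) && (a.2 \in U)) f2 s a != 0.
  by rewrite inS pnatr_eq0 cards_eq0.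
move/negP; apply; apply/eqP/big1 => -[p q] pq.
(* The flow on one entering arc is at most the total inflow #|S|. *)
have := ler_sum_term in_ge0 pq; rewrite inS.
move: pq; rewrite inE /= => /andP[pqE /andP[pU /imsetP[j jS qE]]].
rewrite {q}qE in pqE *; case: p pqE pU => [i|c] pqE pU.
  rewrite mem_Ek_old setUC in pqE; rewrite memU in pU.
  by have [] := f0 _ _ (crossing_cut pqE jS pU).
have /andP[lb ub] := root_capacity2 fs c j.
have : binary (x2 s [set art n c; old k j]).
  by apply: (x2_binary fs); rewrite setUC mem_Ek_art.
(* For x = 0 both root bounds are 0; for x = 1 the flow is at least [alpha], which exceeds #|S|. *)
case=> xE; rewrite xE ?mulr0 ?mulr1 in lb ub => f_le.
  by apply/eqP; rewrite eq_le ub lb.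
by have := le_trans lb f_le; rewrite ler_nat leqNgt hS.
Qed.

Theorem theorem6 (R : realFieldType) (n k alpha : nat)
    (E : {set {set 'I_n}}) (hE : simple_edges E)
    (d : {set 'I_n} -> R) (hd : forall e, e \in E -> 0 <= d e)
    (hk : (2 <= k)%N) (halpha : (2 <= alpha)%N)
    (S : {set 'I_n}) (hS0 : S != set0) (hS : (#|S| < alpha)%N) :
  valid (M := M1 k E d alpha)
    (fun s : vars1 R n k => \sum_c \sum_(e in cut E S) x1 s c e >= 1) /\
  valid (M := M2 k E d alpha)
    (fun s : vars2 R n k => \sum_(e in cut E S) x2 s (old_edge k e) >= 1).
Proof.
split=> s; first exact: cut1_valid.
exact: cut2_valid.
Qed.
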